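(* Let $m, K \geq 1$ be integers, let $\Pi$ be a set of policies, let $V : \Pi \to [0,1]^m$ be the (fixed, unknown) value function, and let $\hat V : \Pi \to \mathbb{R}^m$ be a random function (an estimate of $V$ computed from data). Let $c_i(\pi) \geq 0$ for $i \in [m]$, $\pi \in \Pi$, and let $L_i(\pi) = \hat V_i(\pi) - c_i(\pi)$ be the lower confidence bound, with $L = (L_i)_{i \in [m]}$. Assume $V_i(\pi), L_i(\pi) \in [0,1]$ for all $i \in [m]$ and $\pi \in \Pi$. Suppose that, with probability at least $1-\delta$, the bounds $|V_i(\pi) - \hat V_i(\pi)| \leq c_i(\pi)$ hold jointly for all $i \in [m]$ and all $\pi \in \Pi$. Let $S_* = \arg\max_{S \subseteq \Pi : |S| = K} \mathrm{vol}(S, V)$. Let $\mathrm{Oracle}$ be an $\alpha$-approximate oracle, $\alpha \in [0,1]$, and let $\hat S = \mathrm{Oracle}(\mathrm{vol}(\cdot, L))$. Then with probability at least $1-\delta$, $$\mathrm{vol}(\hat S, V) \;\geq\; \alpha\, \mathrm{vol}(S_*, V) - 2\, c(S_* ),$$ where $c(S) = \sum_{\pi \in S} \sum_{i=1}^m c_i(\pi)$.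
   Context: Notation: $[m] = \{1,\dots,m\}$. For a function $W$ from $\Pi$ to $\mathbb{R}^m$, $W_i(\pi)$ denotes the $i$-th entry of $W(\pi)$. Hypervolume: for $S \subseteq \Pi$ and $W : \Pi \to [0,1]^m$, $$\mathrm{vol}(S, W) = \int_{y \in [0,1]^m} \mathbf{1}\{\exists\, \pi \in S : y \leq W(\pi)\}\, dy,$$ where $y \leq W(\pi)$ is meant entry-wise; that is, the Lebesgue measure of $\bigcup_{\pi \in S} \prod_{i=1}^m [0, W_i(\pi)]$. $\alpha$-approximate oracle: a map that, for any function $\tilde V : \Pi \to [0,1]^m$, computes a set of $K$ policies $\tilde S = \mathrm{Oracle}(\mathrm{vol}(\cdot, \tilde V)) \subseteq \Pi$ such that $$\mathrm{vol}(\tilde S, \tilde V) \geq \alpha \max_{S \subseteq \Pi : |S| = K} \mathrm{vol}(S, \tilde V),$$ i.e. $\mathrm{vol}(\tilde S, \tilde V) \geq \alpha\, \mathrm{vol}(S, \tilde V)$ for every $S \subseteq \Pi$ with $|S| = K$. The maximizer $S_*$ is assumed to exist (any maximizer may be taken). The policies enter only through the values $V(\pi)$, $\hat V(\pi)$, $c_i(\pi)$, so $\Pi$ may be treated as an abstract set. *)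

(* Defs.v *)
From HB Require Import structures.
From mathcomp Require Import all_boot all_order all_algebra.
From mathcomp Require Export finmap.
From mathcomp Require Import all_classical all_reals all_analysis.

Set Implicit Arguments.
Unset Strict Implicit.
Unset Printing Implicit Defensive.

Import Order.TTheory GRing.Theory Num.Theory.
Import numFieldNormedType.Exports.

Local Open Scope classical_set_scope.
Local Open Scope ring_scope.

(* The library has the product sigma-algebra on [n.-tuple T] but no Lebesgue
   measure on it.  It is built here by recursion on [n]: the point mass on the
   one-element space R^0, then the image of [lebesgue_measure \x lambda_n]
   under the measurable isomorphism R x R^n -> R^n.+1.
   [lebesgue_tuple_box] checks the values on boxes. *)
Section lebesgue_tuple.
Local Open Scope ereal_scope.
Variable R : realType.
Local Notation mR := (measurableTypeR R).

Definition tcons n (x : mR * n.-tuple mR) : n.+1.-tuple mR :=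
  [tuple of x.1 :: x.2].

Lemma measurable_tcons n : measurable_fun [set: mR * n.-tuple mR] (@tcons n).
Proof. exact: measurable_cons. Qed.

Section tuple_succ.
Variables (n : nat) (mu : {sigma_finite_measure set (n.-tuple mR) -> \bar R}).

Definition lebesgue_tcons : set (n.+1.-tuple mR) -> \bar R :=
  pushforward (lebesgue_measure \x mu) (@tcons n).

Let mf := @measurable_tcons n.

Let lebesgue_tcons0 : lebesgue_tcons set0 = 0.
Proof. exact: measure0. Qed.

Let lebesgue_tcons_ge0 A : 0 <= lebesgue_tcons A.
Proof. exact: measure_ge0. Qed.

Let lebesgue_tcons_sigma_additive : semi_sigma_additive lebesgue_tcons.
Proof. exact: measure_semi_sigma_additive. Qed.

HB.instance Definition _ := isMeasure.Build _ _ _ lebesgue_tcons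
  lebesgue_tcons0 lebesgue_tcons_ge0 lebesgue_tcons_sigma_additive.

Let lebesgue_tconsE (A : set mR) (B : set (n.-tuple mR)) :
  measurable A -> measurable B ->
  lebesgue_tcons [set t | A (thead t) /\ B [tuple of behead t]] =
  lebesgue_measure A * mu B.
Proof.
move=> mA mB; rewrite -(product_measure1E _ _ mA mB).
congr product_measure1; apply/funext => -[x t] /=.
suff -> : [tuple of behead (tcons (x, t))] = t :> n.-tuple mR by [].
exact: val_inj.
Qed.

Let sigma_finite_lebesgue_tcons : sigma_finite setT lebesgue_tcons.
Proof.
have /sigma_finiteP[F [TF ndF Foo]] := sigma_finiteT (@lebesgue_measure R).
have /sigma_finiteP[G [TG ndG Goo]] := sigma_finiteT mu.
exists (fun i => [set t | F i (thead t) /\ G i [tuple of behead t]]).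
  apply/seteqP; split=> // t _.
  have [i _ Fi] : (\bigcup_i F i) (thead t) by rewrite -TF.
  have [j _ Gj] : (\bigcup_i G i) [tuple of behead t] by rewrite -TG.
  exists (maxn i j) => //; split.
  - by move: Fi; exact/subsetPset/ndF/leq_maxl.
  - by move: Gj; exact/subsetPset/ndG/leq_maxr.
move=> i; have [mF Fi] := Foo i; have [mG Gi] := Goo i; split.
  apply: measurableI; rewrite -[X in measurable X]setTI.
  - exact: measurable_tnth.
  - exact: measurable_behead.
by rewrite lebesgue_tconsE// lte_mul_pinfty// ge0_fin_numE.
Qed.

HB.instance Definition _ := Measure_isSigmaFinite.Build _ _ _ lebesgue_tcons
  sigma_finite_lebesgue_tcons.

End tuple_succ.

Fixpoint lebesgue_tuple n : {sigma_finite_measure set (n.-tuple mR) -> \bar R} :=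
  match n with
  | 0 => \d_([tuple])
  | n.+1 => lebesgue_tcons (lebesgue_tuple n)
  end.

Lemma lebesgue_tuple_box n (A : 'I_n -> set mR) :
  (forall i, measurable (A i)) ->
  lebesgue_tuple n [set y | forall i, A i (tnth y i)] =
  \prod_(i < n) lebesgue_measure (A i).
Proof.
elim: n A => [|n IH] A mA.
  by rewrite big_ord0 /= diracE mem_set// => -[].
rewrite big_ord_recl -IH//= /lebesgue_tcons /pushforward.
rewrite -(product_measure1E _ _ (mA ord0)); last first.
  rewrite [X in measurable X](_ : _ = \bigcap_(i in [set: 'I_n])
    ((fun t : n.-tuple mR => tnth t i) @^-1` A (lift ord0 i))).
    apply: fin_bigcap_measurable => // i _.
    by rewrite -[X in measurable X]setTI; exact: measurable_tnth.
  by apply/seteqP; split=> [y /= h i _|y /= h i]; exact: h.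
congr product_measure1; apply/seteqP; split=> -[x t] /=.
  move=> h; split; first exact: (h ord0).
  by move=> i; have := h (lift ord0 i); rewrite tnthS.
by move=> [h0 h] i; case: (unliftP ord0 i) => [j|] ->//; rewrite tnthS.
Qed.

End lebesgue_tuple.

Section hypervolume.
Variables (R : realType) (m : nat) (Pi : choiceType).

(* [vol] is real-valued: the integral is that of an indicator function over the
   unit cube, hence finite. *)
Definition vol (S : {fset Pi}) (W : Pi -> 'I_m -> R) : R :=
  \int[lebesgue_tuple R m]_(y in [set y | forall i, tnth y i \in `[0, 1]])
    \1_[set y : m.-tuple (measurableTypeR R) |
         exists2 pi, pi \in S & forall i, tnth y i <= W pi i] y.

Definition unit_valued (W : Pi -> 'I_m -> R) : Prop :=
  forall pi i, 0 <= W pi i <= 1.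

(* The oracle only sees the set function [vol(., W)], not [W] itself. *)
Definition approx_oracle (K : nat) (alpha : R)
    (Oracle : ({fset Pi} -> R) -> {fset Pi}) : Prop :=
  forall W, unit_valued W ->
    #|` Oracle (fun S => vol S W)| = K /\
    forall S : {fset Pi}, #|` S| = K ->
      alpha * vol S W <= vol (Oracle (fun S => vol S W)) W.

Definition is_best_set (K : nat) (W : Pi -> 'I_m -> R) (S : {fset Pi}) : Prop :=
  #|` S| = K /\ forall S' : {fset Pi}, #|` S'| = K -> vol S' W <= vol S W.

Definition lcb (Vhat c : Pi -> 'I_m -> R) : Pi -> 'I_m -> R :=
  fun pi i => Vhat pi i - c pi i.

Definition total_width (c : Pi -> 'I_m -> R) (S : {fset Pi}) : R :=
  \sum_(pi <- S) \sum_(i < m) c pi i.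

End hypervolume.

(* The events considered need not be measurable ([Pi] may be uncountable and
   the oracle is arbitrary), so "E holds with probability at least p" means that
   E contains a measurable event of probability at least p; [with_prob_geE]
   recovers the usual meaning for measurable E. *)
Definition with_prob_ge d (T : measurableType d) (R : realType)
    (P : probability T R) (p : R) (E : set T) : Prop :=
  exists A, [/\ measurable A, A `<=` E & (p%:E <= P A)%E].

Lemma with_prob_geE d (T : measurableType d) (R : realType)
    (P : probability T R) (p : R) (E : set T) :
  measurable E -> with_prob_ge P p E <-> (p%:E <= P E)%E.
Proof.
move=> mE; split=> [[A [mA AE pA]]|pE]; last by exists E; split.
by apply: (le_trans pA); apply: le_measure => //; rewrite inE.
Qed.

(* Main.v *)
(* On the confidence event, L <= V <= L + 2c entrywise.  Monotonicity of the
   hypervolume and the oracle guarantee give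
     vol(S_hat, V) >= vol(S_hat, L) >= alpha vol(S_star, L),
   and passing from L back to V on S_star costs at most the total volume of the
   slabs {L_i(pi) < y_i <= V_i(pi)} of the cube, pi in S_star, each of volume
   V_i(pi) - L_i(pi) <= 2 c_i(pi). *)
Require Import Defs.
From mathcomp Require Import all_boot all_order all_algebra.
From mathcomp Require Import all_classical all_reals all_analysis.
From mathcomp Require Import lra.

Set Implicit Arguments.
Unset Strict Implicit.
Unset Printing Implicit Defensive.

Import Order.TTheory GRing.Theory Num.Theory.
Import numFieldNormedType.Exports.

Local Open Scope classical_set_scope.
Local Open Scope ring_scope.

(** Union bound along a list, by induction from the binary case. It serves twice: over the policies
    of a set and over the coordinates. *)
Lemma measure_bigsetU_le d (T : measurableType d) (R : realType)
    (mu : {measure set T -> \bar R}) (I : Type) (s : seq I) (A : I -> set T) :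
  (forall i, measurable (A i)) ->
  (mu (\big[setU/set0]_(i <- s) A i) <= \sum_(i <- s) mu (A i))%E.
Proof.
move=> mA; elim: s => [|i s IH]; first by rewrite !big_nil measure0.
rewrite !big_cons; apply: le_trans (leeD2l _ IH).
by apply: measureU2 => //; exact: bigsetU_measurable.
Qed.

Section hypervolume_theory.
Variables (R : realType) (m : nat).
Local Notation mR := (measurableTypeR R).
Local Notation mu := (lebesgue_tuple R m).

Lemma measurable_tuple_box (A : 'I_m -> set mR) :
  (forall i, measurable (A i)) ->
  measurable [set y : m.-tuple mR | forall i, A i (tnth y i)].
Proof.
move=> mA; rewrite [X in measurable X](_ : _ = \bigcap_(i in [set: 'I_m])
    ((fun t : m.-tuple mR => tnth t i) @^-1` A i)); last first.
  by apply/seteqP; split=> [y h i _|y h i]; exact: h.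
apply: fin_bigcap_measurable => // i _.
by rewrite -[X in measurable X]setTI; exact: measurable_tnth.
Qed.

Definition unit_cube : set (m.-tuple mR) :=
  [set y | forall i, tnth y i \in `[0, 1]].

Lemma measurable_unit_cube : measurable unit_cube.
Proof. by apply: (@measurable_tuple_box (fun=> `[0, 1]%classic)). Qed.

Lemma lebesgue_unit_cube : mu unit_cube = 1%E.
Proof.
rewrite (@lebesgue_tuple_box R m (fun=> `[0, 1]%classic))//.
by rewrite big1// => i _; rewrite lebesgue_measure_itv/= lte01 sube0.
Qed.

(** Open at [a], so that it captures the points failing [tnth y i <= a]. Coordinate [i] is not
    clipped to the unit interval, which makes the measure exactly [b - a] for any [a <= b]. *)
Definition slab (i : 'I_m) (a b : R) : set (m.-tuple mR) :=
  [set y | forall j, (if j == i then `]a, b] else `[0, 1])%classic (tnth y j)].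

Lemma measurable_slab i a b : measurable (slab i a b).
Proof.
apply: (@measurable_tuple_box
  (fun j => if j == i then `]a, b] else `[0, 1])%classic).
by move=> j; case: ifP.
Qed.

Lemma lebesgue_slab i a b : a <= b -> mu (slab i a b) = (b - a)%:E.
Proof.
move=> ab; rewrite (@lebesgue_tuple_box R m
  (fun j => if j == i then `]a, b] else `[0, 1])%classic); last first.
  by move=> j; case: ifP.
rewrite (bigD1 i)//= eqxx big1 => [|j /negPf ->]; last first.
  by rewrite lebesgue_measure_itv/= lte01 sube0.
rewrite mule1 lebesgue_measure_itv/= lte_fin.
(* When [a = b] the interval is empty and both sides are 0. *)
by case: ltgtP ab => // -> _; rewrite subrr.
Qed.

Variable Pi : choiceType.
Implicit Types (S : {fset Pi}) (W : Pi -> 'I_m -> R).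

Definition dominated S W : set (m.-tuple mR) :=
  [set y | exists2 pi, pi \in S & forall i, tnth y i <= W pi i].

Lemma measurable_dominated S W : measurable (dominated S W).
Proof.
rewrite [X in measurable X](_ : _ = \bigcup_(pi in [set` S])
    [set y : m.-tuple mR | forall i, `]-oo, W pi i]%classic (tnth y i)]).
  rewrite bigcup_fset; apply: bigsetU_measurable => pi _.
  by apply: (@measurable_tuple_box (fun i => `]-oo, W pi i]%classic)).
by apply/seteqP; split=> y [pi piS h]; exists pi.
Qed.

Let measurable_dominated_cube S W : measurable (dominated S W `&` unit_cube).
Proof.
apply: measurableI; [exact: measurable_dominated|exact: measurable_unit_cube].
Qed.

(** The real-valued integral loses nothing, since the cube has measure 1. Volumes can then be
    compared through inclusions of sets. *)
Lemma EFin_vol S W : (vol S W)%:E = mu (dominated S W `&` unit_cube).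
Proof.
have mC := measurable_unit_cube.
rewrite /vol /Rintegral integral_indic//; last exact: measurable_dominated.
rewrite fineK// ge0_fin_numE//; apply: le_lt_trans (ltry 1).
rewrite -[X in (_ <= X)%E]lebesgue_unit_cube.
apply: le_measure; rewrite ?inE//.
exact: measurable_dominated_cube.
Qed.

Lemma le_vol S W1 W2 : (forall pi i, W1 pi i <= W2 pi i) ->
  vol S W1 <= vol S W2.
Proof.
move=> W12; rewrite -lee_fin !EFin_vol.
apply: le_measure; rewrite ?inE//; apply: setSI => y [pi piS h].
by exists pi => // i; exact: le_trans (h i) _.
Qed.

(** A point of the cube that lies below [W2 pi] but not below [W1 pi] exceeds [W1 pi i] at some
    coordinate [i], hence lies in the slab between [W1 pi i] and [W2 pi i]. The union bound over all
    these slabs gives the sum. *)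
Lemma vol_le_add S W1 W2 : (forall pi i, W1 pi i <= W2 pi i) ->
  vol S W2 <= vol S W1 + \sum_(pi <- S) \sum_(i < m) (W2 pi i - W1 pi i).
Proof.
move=> W12; rewrite -lee_fin EFinD !EFin_vol.
pose U pi := \big[setU/set0]_(i < m) slab i (W1 pi i) (W2 pi i).
have mU pi : measurable (U pi).
  by apply: bigsetU_measurable => i _; exact: measurable_slab.
have mUS : measurable (\big[setU/set0]_(pi <- S) U pi).
  exact: bigsetU_measurable.
have cover : dominated S W2 `&` unit_cube `<=`
    (dominated S W1 `&` unit_cube) `|` \big[setU/set0]_(pi <- S) U pi.
  move=> y [[pi piS h] yC].
  have [h1|/existsNP[i /negP]] := pselect (forall i, tnth y i <= W1 pi i).
    by left; split=> //; exists pi.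
  rewrite -ltNge => W1y; right; rewrite -bigcup_seq; exists pi => //=.
  rewrite /U -bigcup_seq; exists i; first by rewrite /= mem_index_enum.
  move=> j; case: eqP => [->|_]; last exact: yC.
  by rewrite /= in_itv/= W1y h.
apply: (@le_trans _ _ (mu ((dominated S W1 `&` unit_cube) `|`
    \big[setU/set0]_(pi <- S) U pi))).
  by apply: le_measure; rewrite ?inE//; exact: measurableU.
apply: (le_trans (measureU2 _ _ _)) => //.
apply: leeD2l; apply: (le_trans (measure_bigsetU_le _ _ mU)).
rewrite -sumEFin; apply: lee_sum => pi _.
apply: (le_trans (measure_bigsetU_le _ _ _)) => [i|].
  exact: measurable_slab.
by rewrite -sumEFin; apply: lee_sum => i _; rewrite -(lebesgue_slab i).
Qed.

End hypervolume_theory.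

Theorem theorem2 (R : realType) (d : measure_display) (T : measurableType d)
    (P : probability T R) (m K : nat) (Pi : choiceType)
    (V : Pi -> 'I_m -> R) (Vhat c : Pi -> 'I_m -> {RV P >-> R})
    (delta alpha : R) (Oracle : ({fset Pi} -> R) -> {fset Pi})
    (S_star : {fset Pi}) :
  let cw w := fun pi i => c pi i w in
  let L w := lcb (fun pi i => Vhat pi i w) (cw w) in
  let S_hat w := Oracle (fun S => vol S (L w)) in
  (0 < m)%N -> (0 < K)%N ->
  (forall w pi i, 0 <= cw w pi i) ->
  unit_valued V ->
  (forall w, unit_valued (L w)) ->
  with_prob_ge P (1 - delta)
    [set w | forall i pi, `|V pi i - Vhat pi i w| <= cw w pi i] ->
  is_best_set K V S_star ->
  0 <= alpha <= 1 ->
  approx_oracle m K alpha Oracle ->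
  with_prob_ge P (1 - delta)
    [set w | vol (S_hat w) V
               >= alpha * vol S_star V - 2 * total_width (cw w) S_star].
Proof.
move=> cw L S_hat _ _ c0 V01 L01 [A [mA AE pA]] [S_starK _] /andP[a0 a1] orc.
(* The event [A] witnessing the confidence bounds also witnesses the conclusion; the rest is
   deterministic at a fixed [w]. *)
exists A; split=> // w /AE /= bnd.
have LV pi i : L w pi i <= V pi i.
  by have := bnd i pi; rewrite /L /lcb ler_norml; lra.
have VL pi i : V pi i - L w pi i <= 2 * cw w pi i.
  by have := bnd i pi; rewrite /L /lcb ler_norml; lra.
have [_ /(_ _ S_starK) orcS] := orc (L w) (L01 w).
(* It remains to bound [alpha * vol S_star (L w)] from below. *)
apply: le_trans (le_vol (S_hat w) LV); apply: le_trans orcS.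
rewrite lerBlDr.
have c2 : \sum_(pi <- S_star) \sum_(i < m) (V pi i - L w pi i)
    <= 2 * total_width (cw w) S_star.
  rewrite /total_width mulr_sumr; apply: ler_sum => pi _.
  by rewrite mulr_sumr; apply: ler_sum => i _.
have w0 : 0 <= total_width (cw w) S_star.
  by apply: sumr_ge0 => pi _; apply: sumr_ge0.
have VS : vol S_star V <= vol S_star (L w) + 2 * total_width (cw w) S_star.
  by apply: le_trans (vol_le_add S_star LV) _; rewrite lerD2l.
apply: le_trans (ler_wpM2l a0 VS) _.
by rewrite mulrDr lerD2l ler_piMl// mulr_ge0.
Qed.
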